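(* Let $(A,\ast,\curlyvee)$ be an NS-commutative algebra with the corresponding NS-pre-Lie algebra $(A,\rhd_0,\lhd_0,\circ_0)$, where $x\rhd_0y=y\lhd_0x=x\ast y$ and $x\circ_0y=x\curlyvee y$ for all $x,y\in A$. Let $(A[\![t]\!],\rhd_t,\lhd_t,\circ_t)$ be an NS-pre-Lie algebra deformation of $(A,\rhd_0,\lhd_0,\circ_0)$. Define two bilinear operations $\diamond,\bullet:A\times A\to A$ by $$x\diamond y:=\frac{x\rhd_ty-y\lhd_tx}{t}\Big|_{t=0}=x\rhd_1y-y\lhd_1x,\qquad x\bullet y:=\frac{x\circ_ty-y\circ_tx}{t}\Big|_{t=0}=x\circ_1y-y\circ_1x,$$ for $x,y\in A$. Then $(A,\ast,\curlyvee,\diamond,\bullet)$ is an NS-$F$-manifold algebra.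
   Context: All vector spaces and (multi)linear maps are over a field $\mathbf{k}$ of characteristic $0$. An NS-pre-Lie algebra is a quadruple $(A,\rhd,\lhd,\circ)$ of a vector space $A$ (or a module over a commutative ring such as $\mathbf{k}[\![t]\!]$, with operations bilinear over it) with bilinear operations $\rhd,\lhd,\circ$ such that for all $x,y,z$, with $x\odot y=x\rhd y+x\lhd y+x\circ y$: $$(x\odot y)\rhd z-x\rhd(y\rhd z)=(y\odot x)\rhd z-y\rhd(x\rhd z),$$ $$x\rhd(y\lhd z)-(x\rhd y)\lhd z=y\lhd(x\odot z)-(y\lhd x)\lhd z,$$ $$(x\odot y)\circ z-x\circ(y\odot z)+(x\circ y)\lhd z-x\rhd(y\circ z)=(y\odot x)\circ z-y\circ(x\odot z)+(y\circ x)\lhd z-y\rhd(x\circ z).$$ An NS-pre-Lie algebra deformation of $(A,\rhd_0,\lhd_0,\circ_0)$ consists of $\mathbf{k}[\![t]\!]$-bilinear maps $\rhd_t,\lhd_t,\circ_t:A[\![t]\!]\times A[\![t]\!]\to A[\![t]\!]$ of the form $x\rhd_ty=\sum_{i\ge0}(x\rhd_iy)t^i$, $x\lhd_ty=\sum_{i\ge0}(x\lhd_iy)t^i$, $x\circ_ty=\sum_{i\ge0}(x\circ_iy)t^i$ for $x,y\in A$ (with bilinear maps $\rhd_i,\lhd_i,\circ_i:A\times A\to A$ and the $i=0$ terms being the given ones) such that $(A[\![t]\!],\rhd_t,\lhd_t,\circ_t)$ is an NS-pre-Lie algebra over $\mathbf{k}[\![t]\!]$. An NS-commutative algebra is a triple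 $(A,\ast,\curlyvee)$ of a vector space $A$ with bilinear operations $\ast,\curlyvee$, where $\curlyvee$ is commutative, such that for all $x,y,z\in A$, with $x\odot y=x\ast y+y\ast x+x\curlyvee y$: $$x\ast(y\ast z)=(x\odot y)\ast z,\qquad x\ast(y\curlyvee z)+x\curlyvee(y\odot z)=y\ast(x\curlyvee z)+y\curlyvee(x\odot z).$$ An NS-Lie algebra is a triple $(A,\diamond,\bullet)$ of a vector space $A$ with bilinear operations $\diamond,\bullet$, where $\bullet$ is skew-symmetric, such that for all $x,y,z\in A$, with $\{\!\!\{x,y\}\!\!\}=x\diamond y-y\diamond x+x\bullet y$: $$x\diamond(y\diamond z)-(x\diamond y)\diamond z-y\diamond(x\diamond z)+(y\diamond x)\diamond z=(x\bullet y)\diamond z,$$ $$x\bullet\{\!\!\{y,z\}\!\!\}+y\bullet\{\!\!\{z,x\}\!\!\}+z\bullet\{\!\!\{x,y\}\!\!\}+x\diamond(y\bullet z)+y\diamond(z\bullet x)+z\diamond(x\bullet y)=0.$$ An NS-$F$-manifold algebra is a quintuple $(A,\ast,\curlyvee,\diamond,\bullet)$ such that $(A,\ast,\curlyvee)$ is an NS-commutative algebra, $(A,\diamond,\bullet)$ is an NS-Lie algebra, and for all $x,y,z,w\in A$, with $x\odot y=x\ast y+y\ast x+x\curlyvee y$ and $\{\!\!\{x,y\}\!\!\}=x\diamond y-y\diamond x+x\bullet y$: $$F_1(x\odot y,z,w)=x\ast F_1(y,z,w)+y\ast F_1(x,z,w),$$ $$\big(F_1(x,y,z)+F_1(x,z,y)+F_2(y,z,x)+F_3(x,y,z)\big)\ast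 w=F_2(y,z,x\ast w)-x\ast F_2(y,z,w),$$ $$F_3(x\odot y,z,w)+F_2(z,w,y\curlyvee x)=x\ast F_3(y,z,w)+y\ast F_3(x,z,w)+x\curlyvee\big(F_1(y,z,w)+F_1(y,w,z)+F_2(z,w,y)+F_3(y,z,w)\big)+y\curlyvee\big(F_1(x,z,w)+F_1(x,w,z)+F_2(z,w,x)+F_3(x,z,w)\big),$$ where $F_1,F_2,F_3:A^{\otimes3}\to A$ are $$F_1(x,y,z)=x\diamond(y\ast z)-y\ast(x\diamond z)-\{\!\!\{x,y\}\!\!\}\ast z,$$ $$F_2(x,y,z)=x\ast(y\diamond z)+y\ast(x\diamond z)-(x\odot y)\diamond z,$$ $$F_3(x,y,z)=x\bullet(y\odot z)+x\diamond(y\curlyvee z)-z\ast(x\bullet y)-y\ast(x\bullet z)-y\curlyvee\{\!\!\{x,z\}\!\!\}-\{\!\!\{x,y\}\!\!\}\curlyvee z.$$ *)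

(* Defs.v *)
From HB Require Import structures.
From mathcomp Require Import all_boot all_order all_algebra.
From mathcomp Require Import boolp.

Set Implicit Arguments.
Unset Strict Implicit.
Unset Printing Implicit Defensive.

Import GRing.Theory.
Local Open Scope ring_scope.

(* [pseries V] is V[[t]]: the series [f] is \sum_n (f n) t^n. It is an alias of
   [nat -> V], so that R[[t]] gets the Cauchy product. *)
Definition pseries (V : Type) : Type := nat -> V.

HB.instance Definition _ (V : choiceType) :=
  Choice.copy (pseries V) (nat -> V).

Section Zmodule.
Variable V : zmodType.
Implicit Types f g h : pseries V.

Definition ps_add f g : pseries V := fun n => f n + g n.
Definition ps_opp f : pseries V := fun n => - f n.
Definition ps_zero : pseries V := fun=> 0.

Fact ps_addA : associative ps_add.
Proof. by move=> f g h; apply: funext => n; apply: addrA. Qed.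
Fact ps_addC : commutative ps_add.
Proof. by move=> f g; apply: funext => n; apply: addrC. Qed.
Fact ps_add0 : left_id ps_zero ps_add.
Proof. by move=> f; apply: funext => n; apply: add0r. Qed.
Fact ps_addN : left_inverse ps_zero ps_opp ps_add.
Proof. by move=> f; apply: funext => n; apply: addNr. Qed.

HB.instance Definition _ :=
  GRing.isNmodule.Build (pseries V) ps_addA ps_addC ps_add0.
HB.instance Definition _ := GRing.Nmodule_isZmodule.Build (pseries V) ps_addN.

Definition psC (a : V) : pseries V := fun n => if n == 0%N then a else 0.

End Zmodule.

Section Scale.
Variables (R : comNzRingType) (V : lmodType R).
Implicit Types (a b : pseries R) (f g : pseries V).

Definition ps_scale a f : pseries V :=
  fun n => \sum_(i < n.+1) a i *: f (n - i)%N.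

Lemma ps_scale_rev a f n :
  ps_scale a f n = \sum_(i < n.+1) a (n - i)%N *: f i.
Proof.
rewrite /ps_scale (reindex_inj rev_ord_inj) /=.
by apply: eq_bigr => j _; rewrite (sub_ordK j).
Qed.

Fact ps_scale1 f : ps_scale (psC 1) f = f.
Proof.
apply: funext => n; rewrite /ps_scale big_ord_recl subn0 scale1r.
by rewrite big1 ?addr0 // => i _; rewrite scale0r.
Qed.

Fact ps_scaleDr a f g : ps_scale a (f + g) = ps_scale a f + ps_scale a g.
Proof.
apply: funext => n; rewrite /GRing.add /= /ps_add /ps_scale -big_split.
by apply: eq_bigr => i _; apply: scalerDr.
Qed.

Fact ps_scaleDl f a b : ps_scale (a + b) f = ps_scale a f + ps_scale b f.
Proof.
apply: funext => n; rewrite [RHS]/GRing.add /= /ps_add /ps_scale -big_split.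
by apply: eq_bigr => i _; apply: scalerDl.
Qed.

End Scale.

Definition ps_mul (R : comNzRingType) (a b : pseries R) : pseries R :=
  fun n => \sum_(i < n.+1) a i * b (n - i)%N.

Fact ps_scaleA (R : comNzRingType) (V : lmodType R) (a b : pseries R)
  (f : pseries V) : ps_scale a (ps_scale b f) = ps_scale (ps_mul a b) f.
Proof.
apply: funext => i; rewrite [RHS]ps_scale_rev.
pose coef3 j k := a j *: (b (i - j - k)%N *: f k).
transitivity (\sum_(j < i.+1) \sum_(k < i.+1 | (k <= i - j)%N) coef3 j k).
  apply: eq_bigr => /= j _; rewrite ps_scale_rev scaler_sumr.
  by rewrite (big_ord_narrow_leq (leq_subr _ _)).
rewrite (exchange_big_dep predT) //=; apply: eq_bigr => k _.
transitivity (\sum_(j < i.+1 | (j <= i - k)%N) coef3 j k).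
  apply: eq_bigl => j; rewrite -ltnS -(ltnS j) -!subSn ?leq_ord //.
  by rewrite -subn_gt0 -(subn_gt0 j) -!subnDA addnC.
rewrite (big_ord_narrow_leq (leq_subr _ _)) /ps_mul scaler_suml /=.
by apply: eq_bigr => j _; rewrite /coef3 scalerA -!subnDA addnC.
Qed.

Section Ring.
Variable R : comNzRingType.
Implicit Types a b c : pseries R.

Fact ps_mulA : associative (@ps_mul R).
Proof. by move=> a b c; apply: (@ps_scaleA R R^o a b c). Qed.
Fact ps_mulC : commutative (@ps_mul R).
Proof.
move=> a b; apply: funext => n; rewrite [LHS](@ps_scale_rev R R^o a b n).
by apply: eq_bigr => i _; apply: mulrC.
Qed.
Fact ps_mul1 : left_id (psC 1) (@ps_mul R).
Proof. by move=> a; apply: (@ps_scale1 R R^o a). Qed.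
Fact ps_mulDl : left_distributive (@ps_mul R) +%R.
Proof. by move=> a b c; apply: (@ps_scaleDl R R^o c a b). Qed.
Fact ps_1neq0 : psC (1 : R) != 0.
Proof. by apply/eqP => /(congr1 (@^~ 0%N)) /eqP; rewrite oner_eq0. Qed.

HB.instance Definition _ := GRing.Zmodule_isComNzRing.Build (pseries R)
  ps_mulA ps_mulC ps_mul1 ps_mulDl ps_1neq0.

Definition psT : pseries R := fun n => (n == 1%N)%:R.

End Ring.

HB.instance Definition _ (R : comNzRingType) (V : lmodType R) :=
  GRing.Zmodule_isLmodule.Build (pseries R) (pseries V)
    (@ps_scaleA R V) (@ps_scale1 R V) (@ps_scaleDr R V) (@ps_scaleDl R V).

(* [quot_t_at0 f a]: the series [f] is divisible by t and (f / t)|_{t = 0} = a.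
   The quotient is unique, see [psT_scaleI] below. *)
Definition quot_t_at0 (R : comNzRingType) (V : lmodType R)
    (f : pseries V) (a : V) : Prop :=
  exists2 q : pseries V, f = psT R *: q & q 0%N = a.

Lemma psT_scaleE (R : comNzRingType) (V : lmodType R) (q : pseries V) n :
  (psT R *: q) n = if n is m.+1 then q m else 0.
Proof.
rewrite /GRing.scale /= /ps_scale; case: n => [|n].
  by rewrite big_ord1 scale0r.
rewrite !big_ord_recl scale0r add0r scale1r subn1 big1 ?addr0 // => i _.
exact: scale0r.
Qed.

Lemma psT_scaleI (R : comNzRingType) (V : lmodType R) :
  injective (fun q : pseries V => psT R *: q).
Proof.
move=> p q epq; apply: funext => n.
by have := congr1 (@^~ n.+1) epq; rewrite /= !psT_scaleE.
Qed.

Section Algebras.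
Variables (R : comNzRingType) (A : lmodType R).

Definition is_bilinear (op : A -> A -> A) : Prop :=
  (forall x, linear (op x)) /\ (forall y, linear (op^~ y)).

Section NSpreLie.
Variables rhd lhd circ : A -> A -> A.
Local Notation "x ▷ y" := (rhd x y) (at level 40).
Local Notation "x ◁ y" := (lhd x y) (at level 40).
Local Notation "x ∘ y" := (circ x y) (at level 40).

Definition preLie_odot x y := x ▷ y + x ◁ y + x ∘ y.
Local Notation "x ⊙ y" := (preLie_odot x y) (at level 40).

Record NS_preLie : Prop := {
  preLie_rhd_bilinear : is_bilinear rhd;
  preLie_lhd_bilinear : is_bilinear lhd;
  preLie_circ_bilinear : is_bilinear circ;
  preLie_axiom1 : forall x y z,
    (x ⊙ y) ▷ z - x ▷ (y ▷ z) = (y ⊙ x) ▷ z - y ▷ (x ▷ z);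
  preLie_axiom2 : forall x y z,
    x ▷ (y ◁ z) - (x ▷ y) ◁ z = y ◁ (x ⊙ z) - (y ◁ x) ◁ z;
  preLie_axiom3 : forall x y z,
    (x ⊙ y) ∘ z - x ∘ (y ⊙ z) + (x ∘ y) ◁ z - x ▷ (y ∘ z)
    = (y ⊙ x) ∘ z - y ∘ (x ⊙ z) + (y ∘ x) ◁ z - y ▷ (x ∘ z) }.

End NSpreLie.

Section NScommutative.
Variables ast vee : A -> A -> A.
Local Notation "x ∗ y" := (ast x y) (at level 40).
Local Notation "x ⋎ y" := (vee x y) (at level 40).

Definition comm_odot x y := x ∗ y + y ∗ x + x ⋎ y.
Local Notation "x ⊙ y" := (comm_odot x y) (at level 40).

Record NS_commutative : Prop := {
  comm_ast_bilinear : is_bilinear ast;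
  comm_vee_bilinear : is_bilinear vee;
  comm_veeC : commutative vee;
  comm_axiom1 : forall x y z, x ∗ (y ∗ z) = (x ⊙ y) ∗ z;
  comm_axiom2 : forall x y z,
    x ∗ (y ⋎ z) + x ⋎ (y ⊙ z) = y ∗ (x ⋎ z) + y ⋎ (x ⊙ z) }.

End NScommutative.

Section NSLie.
Variables diam bul : A -> A -> A.
Local Notation "x ⋄ y" := (diam x y) (at level 40).
Local Notation "x • y" := (bul x y) (at level 40).

Definition Lie_bracket x y := x ⋄ y - y ⋄ x + x • y.
Local Notation "⦃ x , y ⦄" := (Lie_bracket x y) (at level 0).

Record NS_Lie : Prop := {
  Lie_diam_bilinear : is_bilinear diam;
  Lie_bul_bilinear : is_bilinear bul;
  Lie_bul_skew : forall x y, x • y = - (y • x);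
  Lie_axiom1 : forall x y z,
    x ⋄ (y ⋄ z) - (x ⋄ y) ⋄ z - y ⋄ (x ⋄ z) + (y ⋄ x) ⋄ z = (x • y) ⋄ z;
  Lie_axiom2 : forall x y z,
    x • ⦃y, z⦄ + y • ⦃z, x⦄ + z • ⦃x, y⦄
    + x ⋄ (y • z) + y ⋄ (z • x) + z ⋄ (x • y) = 0 }.

End NSLie.

Section NSFmanifold.
Variables ast vee diam bul : A -> A -> A.
Local Notation "x ∗ y" := (ast x y) (at level 40).
Local Notation "x ⋎ y" := (vee x y) (at level 40).
Local Notation "x ⋄ y" := (diam x y) (at level 40).
Local Notation "x • y" := (bul x y) (at level 40).
Local Notation "x ⊙ y" := (comm_odot ast vee x y) (at level 40).
Local Notation "⦃ x , y ⦄" := (Lie_bracket diam bul x y) (at level 0).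

Definition NSF_F1 x y z := x ⋄ (y ∗ z) - y ∗ (x ⋄ z) - ⦃x, y⦄ ∗ z.
Definition NSF_F2 x y z := x ∗ (y ⋄ z) + y ∗ (x ⋄ z) - (x ⊙ y) ⋄ z.
Definition NSF_F3 x y z :=
  x • (y ⊙ z) + x ⋄ (y ⋎ z) - z ∗ (x • y) - y ∗ (x • z)
  - y ⋎ ⦃x, z⦄ - ⦃x, y⦄ ⋎ z.
Local Notation F1 := NSF_F1.
Local Notation F2 := NSF_F2.
Local Notation F3 := NSF_F3.

Record NS_Fmanifold : Prop := {
  Fman_commutative : NS_commutative ast vee;
  Fman_Lie : NS_Lie diam bul;
  Fman_axiom1 : forall x y z w,
    F1 (x ⊙ y) z w = x ∗ F1 y z w + y ∗ F1 x z w;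
  Fman_axiom2 : forall x y z w,
    (F1 x y z + F1 x z y + F2 y z x + F3 x y z) ∗ w
    = F2 y z (x ∗ w) - x ∗ F2 y z w;
  Fman_axiom3 : forall x y z w,
    F3 (x ⊙ y) z w + F2 z w (y ⋎ x)
    = x ∗ F3 y z w + y ∗ F3 x z w
      + x ⋎ (F1 y z w + F1 y w z + F2 z w y + F3 y z w)
      + y ⋎ (F1 x z w + F1 x w z + F2 z w x + F3 x z w) }.

End NSFmanifold.

Lemma NS_commutative_preLie (ast vee : A -> A -> A) :
  NS_commutative ast vee -> NS_preLie ast (fun x y => ast y x) vee.
Proof.
case=> [[astr astl] vee_bil veeC ax1 ax2].
have odotC x y : comm_odot ast vee x y = comm_odot ast vee y x.
  by rewrite /comm_odot veeC [_ + ast y x]addrC.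
have eq_odot x y :
  preLie_odot ast (fun x y => ast y x) vee x y = comm_odot ast vee x y by [].
split=> // [x y z|x y z|x y z]; rewrite !eq_odot.
- by rewrite -!ax1 !subrr.
- by rewrite !ax1 [comm_odot _ _ z x]odotC.
- rewrite (odotC y x) (veeC y x) -!addrA; congr (_ + _).
  rewrite addrCA [RHS]addrCA; congr (_ + _).
  by rewrite -!opprD [X in - X]addrC ax2 [X in - X]addrC.
Qed.

End Algebras.

(* The operations on A[[t]] are determined by their restriction to constant
   series, because a k[[t]]-bilinear map is t-adically continuous. *)
Record NS_preLie_deformation (K : fieldType) (A : lmodType K)
    (rhd0 lhd0 circ0 : A -> A -> A)
    (rhd lhd circ : nat -> A -> A -> A)
    (rhdt lhdt circt : pseries A -> pseries A -> pseries A) : Prop := {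
  def_rhd_bilinear : forall i, is_bilinear (rhd i);
  def_lhd_bilinear : forall i, is_bilinear (lhd i);
  def_circ_bilinear : forall i, is_bilinear (circ i);
  def_rhd0 : rhd 0%N =2 rhd0;
  def_lhd0 : lhd 0%N =2 lhd0;
  def_circ0 : circ 0%N =2 circ0;
  def_rhdt : forall x y : A, rhdt (psC x) (psC y) = fun i => rhd i x y;
  def_lhdt : forall x y : A, lhdt (psC x) (psC y) = fun i => lhd i x y;
  def_circt : forall x y : A, circt (psC x) (psC y) = fun i => circ i x y;
  def_NS_preLie : @NS_preLie (pseries K) (pseries A) rhdt lhdt circt }.

(* Main.v *)
Require Import Defs.
From mathcomp Require Import all_boot all_order all_algebra.
From mathcomp Require Import boolp.

(** The theorem is the NS version of a fact about ordinary pre-Lie algebras: if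
    a pre-Lie product on a module M, on which t acts injectively, is commutative
    modulo t, then the product and the bracket (XY - YX) / t make M / tM an
    F-manifold algebra.

    Reduction to the ordinary case.  An NS-algebra structure on A amounts to an
    ordinary structure on A x A: given operations a, b, c, let A act on the
    second factor from the left by a and from the right by b, and twist the
    semidirect product by c, so that
      (x, u) (y, v) = (a x y + b x y + c x y, a x v + b u y + c x y).
    If (a, b, c) is NS-pre-Lie, this product is pre-Lie ([semidirect_leftsym]).
    Conversely the second components of the F-manifold identities on A x A,
    with the arguments taken from A x 0 or 0 x A, are the defining identities
    of an NS-F-manifold algebra ([NS_Lie_of_semidirect],
    [NS_Fmanifold_of_semidirect]); F_1, F_2, F_3 are the components of the
    failure of the bracket to be a derivation of the product.

    The ordinary case.  In a pre-Lie algebra put [X, Y] = XY - YX and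
      L(X; Y, Z) = [X, YZ] - [X, Y] Z - Y [X, Z].
    Left symmetry gives [X, Y] Z = X (YZ) - Y (XZ), whence
      L(X; Y, Z) = - (Y, Z, X),
    where (Y, Z, X) = (YZ) X - Y (ZX) is the associator
    ([commutator_leibnizator]).  Thus L is at once minus the associator, which
    satisfies the five-term identity, and, up to sign, the Hochschild coboundary
    of [X, -], which is a cocycle up to associators.  Comparing the two
    identities gives
      L(XY; Z, W) = X L(Y; Z, W) + Y L(X; Z, W) + (error),
    where each term of the error is a commutator involving L, or an L one of
    whose arguments is a commutator ([commutator_leibnizator_mul]).  When
    commutators are divisible by t, so is L, and the error is divisible by t^2;
    dividing by t and reducing modulo t leaves the Hertling-Manin relation.
    The Jacobi identity of the commutator may be divided by t^2 before reducing.

    All of this is applied to M = A[[t]] x A[[t]].  The product there is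
    commutative modulo t because at t = 0 the right action is the left action
    with its arguments exchanged and the twisting cocycle is commutative. *)

Set Implicit Arguments.
Unset Strict Implicit.
Unset Printing Implicit Defensive.

Import GRing.Theory.
Local Open Scope ring_scope.

(** * Deciding identities in abelian groups *)

(** Syntax of group expressions over a list of atoms: [zmodule] proves an
    equality by comparing the integer coefficients of every atom. *)
Inductive zexpr :=
  ZVar of nat | ZZero | ZAdd of zexpr & zexpr | ZOpp of zexpr.

Fixpoint zeval (V : zmodType) (env : seq V) e : V :=
  match e with
  | ZVar k => env`_k
  | ZZero => 0
  | ZAdd e1 e2 => zeval env e1 + zeval env e2
  | ZOpp e1 => - zeval env e1
  end.

Fixpoint zcoef e (i : nat) : int :=
  match e with
  | ZVar k => (i == k)%:Z
  | ZZero => 0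
  | ZAdd e1 e2 => zcoef e1 i + zcoef e2 i
  | ZOpp e1 => - zcoef e1 i
  end.

Lemma zeval_coef (V : zmodType) (env : seq V) e :
  zeval env e = \sum_(i < size env) env`_i *~ zcoef e i.
Proof.
elim: e => [k||e1 IH1 e2 IH2|e1 IH1] /=.
- have [ltk|lek] := ltnP k (size env); last first.
    (* An index past the end of the list denotes the default value 0. *)
    rewrite nth_default // big1 // => i _.
    by rewrite ltn_eqF // (leq_trans (ltn_ord i)).
  rewrite (bigD1 (Ordinal ltk)) //= eqxx big1 ?addr0 // => i.
  by rewrite -val_eqE /= => /negPf ->.
- by rewrite big1.
- by rewrite IH1 IH2 -big_split; apply: eq_bigr => i _; rewrite /= mulrzDr.
- by rewrite IH1 -sumrN; apply: eq_bigr => i _; rewrite mulrNz.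
Qed.

Lemma zeval_eq (V : zmodType) (env : seq V) e1 e2 :
  all (fun i => zcoef e1 i == zcoef e2 i) (iota 0 (size env)) ->
  zeval env e1 = zeval env e2.
Proof.
move=> /allP eq12; rewrite !zeval_coef; apply: eq_bigr => i _.
by rewrite (eqP (eq12 i _)) // mem_iota /=.
Qed.

Ltac zindex x env :=
  lazymatch env with
  | x :: _ => constr:(0%N)
  | _ :: ?s => let k := zindex x s in constr:(S k)
  end.

(* Whatever is neither a sum, an opposite nor 0 is an atom, up to syntactic
   equality: expressions have to be expanded by bilinearity beforehand. *)
Ltac zatoms env e :=
  lazymatch e with
  | @GRing.add _ ?a ?b => let s := zatoms env a in zatoms s b
  | @GRing.opp _ ?a => zatoms env a
  | @GRing.zero _ => env
  | _ => match env with
         | _ => let k := zindex e env in env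
         | _ => constr:(e :: env)
         end
  end.

Ltac zreify env e :=
  lazymatch e with
  | @GRing.add _ ?a ?b =>
      let a' := zreify env a in let b' := zreify env b in constr:(ZAdd a' b')
  | @GRing.opp _ ?a => let a' := zreify env a in constr:(ZOpp a')
  | @GRing.zero _ => constr:(ZZero)
  | _ => let k := zindex e env in constr:(ZVar k)
  end.

Ltac zmodule :=
  lazymatch goal with
  | |- @eq ?V ?lhs ?rhs =>
    let s := zatoms (@nil V) lhs in
    let env := zatoms s rhs in
    let e1 := zreify env lhs in
    let e2 := zreify env rhs in
    apply: (@zeval_eq _ env e1 e2); vm_compute; reflexivity
  end.

(** With [eqrD], the way to derive an identity as a combination of known ones:
    [a = b] is their sum, and [zmodule] proves the second premise. *)
Lemma eq_of_subr (V : zmodType) (a b c d : V) :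
  a = b -> c - d = a - b -> c = d.
Proof. by move=> ->; rewrite subrr => /subr0_eq. Qed.

Lemma eqrD (V : zmodType) (a b c d : V) : a = b -> c = d -> a + c = b + d.
Proof. by move=> -> ->. Qed.

(** * Bilinear operations *)

Section Bilinear.
Variables (R : comNzRingType) (A : lmodType R).

Lemma bilinearE (op : A -> A -> A) : is_bilinear op ->
  ((forall x y z, op (x + y)%R z = (op x z + op y z)%R) *
   (forall x y z, op x (y + z)%R = (op x y + op x z)%R) *
   (forall x y, op (- x) y = - op x y) * (forall x y, op x (- y) = - op x y) *
   (forall x, op 0 x = 0) * (forall x, op x 0 = 0))%type.
Proof.
case=> opr opl.
have Dl x y z : op (x + y) z = op x z + op y z.
  by have := opl z 1 x y; rewrite !scale1r.
have Dr x y z : op x (y + z) = op x y + op x z.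
  by have := opr x 1 y z; rewrite !scale1r.
have ol x : op 0 x = 0 by apply: (addrI (op 0 x)); rewrite -Dl !addr0.
have o_r x : op x 0 = 0 by apply: (addrI (op x 0)); rewrite -Dr !addr0.
have Nl x y : op (- x) y = - op x y.
  by apply/eqP; rewrite -addr_eq0 -Dl addNr ol.
have Nr x y : op x (- y) = - op x y.
  by apply/eqP; rewrite -addr_eq0 -Dr addNr o_r.
exact: (Dl, Dr, Nl, Nr, ol, o_r).
Qed.

Lemma bilinearZl (op : A -> A -> A) : is_bilinear op ->
  forall a x y, op (a *: x) y = a *: op x y.
Proof.
move=> h a x y; have [_ opl] := h.
by have := opl y a x 0; rewrite !addr0 (bilinearE h) addr0.
Qed.

Lemma bilinearZr (op : A -> A -> A) : is_bilinear op ->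
  forall a x y, op x (a *: y) = a *: op x y.
Proof.
move=> h a x y; have [opr _] := h.
by have := opr x a y 0; rewrite !addr0 (bilinearE h) addr0.
Qed.

Lemma bilinear_sub_swap u v : is_bilinear u -> is_bilinear v ->
  is_bilinear (fun x y : A => u x y - v y x).
Proof.
move=> hu hv; split=> x k y z;
  rewrite !(bilinearE hu, bilinearE hv)
    !(bilinearZl hu, bilinearZl hv, bilinearZr hu, bilinearZr hv) scalerBr;
  zmodule.
Qed.

End Bilinear.

(** * Pre-Lie products that commute modulo t *)

Section Defects.
Variable M : zmodType.

Definition associator (mul : M -> M -> M) x y z :=
  mul (mul x y) z - mul x (mul y z).

Definition leibnizator (mul br : M -> M -> M) x y z :=
  br x (mul y z) - mul (br x y) z - mul y (br x z).

End Defects.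

Section PreLie.
Variables (R : comNzRingType) (M : lmodType R).
Variables (t : R) (mul br : M -> M -> M).
Hypothesis t_regular : injective (fun x : M => t *: x).
Hypothesis mul_bil : is_bilinear mul.
Hypothesis mul_leftsym :
  forall x y z, associator mul x y z = associator mul y x z.
Hypothesis brE : forall x y, t *: br x y = mul x y - mul y x.

Local Notation assoc := (associator mul).
Local Notation leib := (leibnizator mul br).
Local Notation mulE := (bilinearE mul_bil).
Local Notation mulZl := (bilinearZl mul_bil).
Local Notation mulZr := (bilinearZr mul_bil).

Let comm x y := mul x y - mul y x.

Lemma associatorZ a x y z :
  [/\ assoc (a *: x) y z = a *: assoc x y z,
      assoc x (a *: y) z = a *: assoc x y z
    & assoc x y (a *: z) = a *: assoc x y z].
Proof. by split; rewrite /associator ?(mulZl, mulZr) scalerBr. Qed.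

(** Left symmetry says that left multiplication represents the commutator
    bracket. *)
Lemma commutator_mul x y z :
  mul (comm x y) z = mul x (mul y z) - mul y (mul x z).
Proof.
have h := mul_leftsym x y z; apply/eqP; rewrite -subr_eq0.
rewrite -(subrr (assoc x y z)) {2}h; apply/eqP.
by rewrite /comm /associator !mulE; zmodule.
Qed.

(** Valid for every bilinear product: each of the five bracketings of
    x, y, z, w occurs twice, with opposite signs. *)
Lemma associator_five_term x y z w :
  mul x (assoc y z w) - assoc (mul x y) z w + assoc x (mul y z) w
  - assoc x y (mul z w) + mul (assoc x y z) w = 0.
Proof. by rewrite /associator !mulE; zmodule. Qed.

(** After [commutator_mul], the terms x (yz) and y (xz) cancel, and only
    y (zx) - (yz) x is left. *)
Lemma commutator_leibnizator x y z :
  leibnizator mul comm x y z = - assoc y z x.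
Proof.
rewrite /leibnizator commutator_mul /comm /associator !mulE; zmodule.
Qed.

Lemma scale_leibnizator x y z : t *: leib x y z = - assoc y z x.
Proof.
by rewrite -commutator_leibnizator /leibnizator !scalerBr -mulZl -mulZr !brE.
Qed.

(** The t^2-multiple of the left-hand side is the Jacobiator of the
    commutator, which vanishes in every pre-Lie algebra. *)
Lemma br_Jacobi x y z : br x (br y z) + br y (br z x) + br z (br x y) = 0.
Proof.
have tbr u v w : t *: (t *: br u (br v w)) = comm u (comm v w).
  by rewrite brE scalerBr -(mulZr t u) -(mulZl t _ u) brE.
apply: t_regular; apply: t_regular; rewrite /= !scalerDr !tbr !scaler0.
rewrite {1 3 5}/comm !commutator_mul /comm !mulE; zmodule.
Qed.

(** The coboundary [L] of [D] is a Hochschild cocycle when the product is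
    associative; in general its coboundary is the defect of [D] to be a
    derivation of the associator. *)
Lemma derivation_defect D x y z :
    {morph D : u v / u - v} ->
  let L u v := D (mul u v) - mul (D u) v - mul u (D v) in
  mul x (L y z) - L (mul x y) z + L x (mul y z) - mul (L x y) z
  = assoc (D x) y z + assoc x (D y) z + assoc x y (D z) - D (assoc x y z).
Proof. by move=> DB; rewrite /= /associator !DB !mulE; zmodule. Qed.

(** Put D = [y, -] in [derivation_defect], so that the coboundary there is
    L(y; -, -) = - (-, -, y).  Three terms of its left-hand side then also occur
    in the five-term identity for z, w, x, y; eliminating them leaves a formula
    for L(xy; z, w) = - (z, w, xy).  The error is written so that every term
    becomes divisible by t^2 once commutators are divisible by t; the
    commutators of L(x; z, w) with y, one from D applied to (z, w, x) and one
    from moving y to the left of L(x; z, w), cancel. *)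
Lemma commutator_leibnizator_mul x y z w :
  let L := leibnizator mul comm in
  L (mul x y) z w = mul x (L y z w) + mul y (L x z w)
    + (comm (L y z w) x - L (comm y x) z w - L x (comm y z) w
       - L x z (comm y w)).
Proof.
move=> L.
have LE u v s : L u v s = - assoc v s u := commutator_leibnizator u v s.
have commB : {morph comm y : u v / u - v}.
  by move=> u v; rewrite /comm !mulE; zmodule.
have h5 := associator_five_term z w x y.
have hD : mul z (L y w x) - L y (mul z w) x + L y z (mul w x)
          - mul (L y z w) x
        = assoc (comm y z) w x + assoc z (comm y w) x + assoc z w (comm y x)
          - comm y (assoc z w x) := derivation_defect z w x commB.
apply: (eq_of_subr (eqrD hD h5)).
rewrite /= !LE /comm !mulE; zmodule.
Qed.

(** The Hertling-Manin relation modulo t: [commutator_leibnizator_mul] divided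
    by t, the error term retaining one factor t. *)
Lemma leibnizator_mul x y z w :
  leib (mul x y) z w = mul x (leib y z w) + mul y (leib x z w)
    + t *: (br (leib y z w) x - leib (br y x) z w - leib x (br y z) w
            - leib x z (br y w)).
Proof.
have := commutator_leibnizator_mul x y z w; rewrite /=.
have lE u v s : leibnizator mul comm u v s = t *: leib u v s.
  by rewrite scale_leibnizator commutator_leibnizator.
have LZ a u v s :
  [/\ leibnizator mul comm (a *: u) v s = a *: leibnizator mul comm u v s,
      leibnizator mul comm u (a *: v) s = a *: leibnizator mul comm u v s
    & leibnizator mul comm u v (a *: s) = a *: leibnizator mul comm u v s].
  rewrite !commutator_leibnizator; case: (associatorZ a v s u) => -> -> ->.
  by rewrite !scalerN.
have commE u v : comm u v = t *: br u v by rewrite brE.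
(* The two Leibniz defects are abstracted so that the scaling rules do not
   distribute inside them. *)
move: (leibnizator mul comm) (leib) lE LZ => L l lE LZ Lxy.
apply: t_regular; rewrite /= -!lE Lxy scalerDr (scalerDr t (mul x _)).
rewrite !lE -!(mulZr t); congr (_ + _).
rewrite -!lE !commE; case: (LZ t (br y x) z w) => -> _ _.
case: (LZ t x (br y z) w) => _ -> _; case: (LZ t x z (br y w)) => _ _ ->.
by rewrite !lE -commE /comm mulZl mulZr -scalerBr -brE -!scalerBr.
Qed.

(** The quotient M / tM is represented by a split surjection [red] killing tM,
    compatible with the operations. *)
Section Reduction.
Variables (B : zmodType) (mul0 br0 : B -> B -> B) (red : M -> B)
  (lift : B -> M).
Hypothesis redD : {morph red : x y / x + y}.
Hypothesis liftK : cancel lift red.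
Hypothesis red_t : forall x, red (t *: x) = 0.
Hypothesis red_mul : forall x y, red (mul x y) = mul0 (red x) (red y).
Hypothesis red_br : forall x y, red (br x y) = br0 (red x) (red y).

Let redB : {morph red : x y / x - y}.
Proof. by move=> x y; rewrite -[in RHS](subrK y x) [in RHS]redD addrK. Qed.

Lemma reduced_Jacobi x y z :
  br0 x (br0 y z) + br0 y (br0 z x) + br0 z (br0 x y) = 0.
Proof.
rewrite -(liftK x) -(liftK y) -(liftK z) -!red_br -!redD.
by rewrite br_Jacobi -(scaler0 _ t) red_t.
Qed.

Lemma reduced_leibnizator_mul x y z w :
  let leib0 := leibnizator mul0 br0 in
  leib0 (mul0 x y) z w = mul0 x (leib0 y z w) + mul0 y (leib0 x z w).
Proof.
have redL u v s :
    red (leib u v s) = leibnizator mul0 br0 (red u) (red v) (red s).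
  by rewrite /leibnizator !redB !(red_mul, red_br).
rewrite /= -(liftK x) -(liftK y) -(liftK z) -(liftK w).
rewrite -(red_mul (lift x)) -!redL -!red_mul -redD leibnizator_mul.
by rewrite redD red_t addr0.
Qed.

End Reduction.

End PreLie.

(** * NS-structures as twisted semidirect products *)

Section Semidirect.
Variables (R : comNzRingType) (A : lmodType R).

(** The first component is the second one evaluated at (X.1, X.1), (Y.1, Y.1):
    the diagonal of A x A is a subalgebra, a copy of A with the product
    a + b + c.  Identities in the second component therefore imply those in the
    first. *)
Definition semidirect (a b c : A -> A -> A) (X Y : A * A) : A * A :=
  (a X.1 Y.1 + b X.1 Y.1 + c X.1 Y.1, a X.1 Y.2 + b X.2 Y.1 + c X.1 Y.1).

Lemma semidirect_bilinear a b c : is_bilinear a -> is_bilinear b ->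
  is_bilinear c -> is_bilinear (semidirect a b c).
Proof.
move=> ha hb hc.
split=> [[x u] k [y v] [z w]|[x u] k [y v] [z w]]; congr (_, _);
  rewrite /= !(bilinearE ha, bilinearE hb, bilinearE hc)
    ?(bilinearZl ha, bilinearZl hb, bilinearZl hc,
      bilinearZr ha, bilinearZr hb, bilinearZr hc) !scalerDr; zmodule.
Qed.

(** In the second component, the terms containing w cancel by the first
    NS-pre-Lie axiom, those containing u or v by the second, and those
    containing only x, y, z by the third. *)
Lemma semidirect_leftsym a b c : NS_preLie a b c -> forall X Y Z,
  associator (semidirect a b c) X Y Z = associator (semidirect a b c) Y X Z.
Proof.
case=> ha hb hc ax1 ax2 ax3.
have E := (bilinearE ha, bilinearE hb, bilinearE hc).
(* [assoc2] is the second component of the associator. *)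
pose assoc2 x y z u v w := a (preLie_odot a b c x y) w
  + b (a x v + b u y + c x y) z + c (preLie_odot a b c x y) z
  - (a x (a y w + b v z + c y z) + b u (preLie_odot a b c y z)
     + c x (preLie_odot a b c y z)).
have assoc2C x y z u v w : assoc2 x y z u v w = assoc2 y x z v u w.
  have h := eqrD (eqrD (ax1 x y w) (ax3 x y z))
                 (eqrD (esym (ax2 x v z)) (ax2 y u z)).
  apply: (eq_of_subr h); rewrite /assoc2 /preLie_odot !E; zmodule.
move=> [x u] [y v] [z w].
by congr (_, _); [apply: (assoc2C x y z x y z)|apply: (assoc2C x y z u v w)].
Qed.

Variables ast vee diam bul : A -> A -> A.
Let mul0 := semidirect ast (fun x y => ast y x) vee.
(* The right action of the bracket is minus its left action, as for the
   semidirect product of a Lie algebra with a module. *)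
Let br0 := semidirect diam (fun x y => - diam y x) bul.
Local Notation F1 := (NSF_F1 ast diam bul).
Local Notation F2 := (NSF_F2 ast vee diam).
Local Notation F3 := (NSF_F3 ast vee diam bul).

Lemma NS_Lie_of_semidirect :
  is_bilinear diam -> is_bilinear bul -> (forall x y, bul x y = - bul y x) ->
  (forall X Y Z, br0 X (br0 Y Z) + br0 Y (br0 Z X) + br0 Z (br0 X Y) = 0) ->
  NS_Lie diam bul.
Proof.
move=> hd hb skew jac; have E := (bilinearE hd, bilinearE hb).
split=> // x y z.
  have /= := congr1 snd (jac (x, 0) (y, 0) (0, z)).
  rewrite /= !E => h; apply: (eq_of_subr h).
  rewrite /Lie_bracket ?E; zmodule.
have /= := congr1 snd (jac (x, 0) (y, 0) (z, 0)).
rewrite /= !E => h; apply: (eq_of_subr h).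
rewrite /Lie_bracket ?E; zmodule.
Qed.

(** The defect of the bracket on A x A has second component
    F1 x y w + F1 x z v + F2 y z u + F3 x y z; on the diagonal this becomes the
    sum of F's in the second and third axioms, which is therefore its first
    component.  Each axiom results from placing one argument, or none, in the
    second factor. *)
Lemma NS_Fmanifold_of_semidirect :
  NS_commutative ast vee -> NS_Lie diam bul ->
  (let leib0 := leibnizator mul0 br0 in forall X Y Z W,
    leib0 (mul0 X Y) Z W = mul0 X (leib0 Y Z W) + mul0 Y (leib0 X Z W)) ->
  NS_Fmanifold ast vee diam bul.
Proof.
move=> hA hL /= HM.
have [ha hv veeC _ _] := hA; have [hd hb skew _ _] := hL.
have E := (bilinearE ha, bilinearE hv, bilinearE hd, bilinearE hb).
pose G x y z u v w := F1 x y w + F1 x z v + F2 y z u + F3 x y z.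
have leibE X Y Z : leibnizator mul0 br0 X Y Z =
    (G X.1 Y.1 Z.1 X.1 Y.1 Z.1, G X.1 Y.1 Z.1 X.2 Y.2 Z.2).
  case: X Y Z => [x u] [y v] [z w].
  congr (_, _); rewrite /G /NSF_F1 /NSF_F2 /NSF_F3 /comm_odot
    /Lie_bracket /=; rewrite !E; zmodule.
have F1_0 x y : (F1 x y 0 = 0) * (F1 x 0 y = 0) * (F1 0 x y = 0).
  by do !split; rewrite /NSF_F1 /Lie_bracket !E; zmodule.
have F2_0 x y : (F2 x y 0 = 0) * (F2 x 0 y = 0) * (F2 0 x y = 0).
  by do !split; rewrite /NSF_F2 /comm_odot !E; zmodule.
have F3_0 x y : (F3 x y 0 = 0) * (F3 x 0 y = 0) * (F3 0 x y = 0).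
  by do !split; rewrite /NSF_F3 /comm_odot /Lie_bracket !E; zmodule.
have op0 (op : A -> A -> A) : is_bilinear op ->
    (forall x, op 0 x = 0) * (forall x, op x 0 = 0).
  by move=> h; split=> x; rewrite (bilinearE h).
have E0 := (op0 _ ha, op0 _ hv, F1_0, F2_0, F3_0, @addr0 A, @add0r A).
have HM2 X Y Z W := congr1 snd (HM X Y Z W).
split=> // x y z w.
- have := HM2 (x, 0) (y, 0) (z, 0) (0, w).
  by rewrite !leibE /= /G !E0.
- have := HM2 (x, 0) (0, w) (y, 0) (z, 0).
  by rewrite !leibE /= /G !E0 => ->; rewrite [_ + ast _ w]addrC addrK.
- have := HM2 (x, 0) (y, 0) (z, 0) (w, 0).
  rewrite !leibE /= /G !E0 (veeC y x).
  by rewrite [F2 _ _ _ + _]addrC => ->; rewrite addrACA !addrA.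
Qed.

End Semidirect.

(** * Low-order coefficients of bilinear operations on power series *)

Section Series.
Variables (K : comNzRingType) (A : lmodType K).
Implicit Types f g : pseries A.

Definition ps_shift f : pseries A := fun n => f n.+1.

Lemma ps_shiftE f : f = psC (f 0%N) + psT K *: ps_shift f.
Proof.
apply: funext => n; rewrite -[RHS]/(psC (f 0%N) n + (psT K *: ps_shift f) n).
by rewrite psT_scaleE /psC; case: n => [|n] /=; rewrite ?addr0 ?add0r.
Qed.

Lemma psT_shift f : f 0%N = 0 -> psT K *: ps_shift f = f.
Proof. by move=> f0; apply: funext => n; rewrite psT_scaleE; case: n. Qed.

(* Splitting f = f 0 + t * shift f in both arguments expresses the first
   coefficients of [op] through its values on constant series. *)
Variable op : pseries A -> pseries A -> pseries A.
Hypothesis op_bil : is_bilinear op.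

Lemma coef0_bilinear f g :
  op f g 0%N = op (psC (f 0%N)) (psC (g 0%N)) 0%N.
Proof.
rewrite {1}(ps_shiftE f) {1}(ps_shiftE g) !(bilinearE op_bil).
rewrite !(bilinearZl op_bil, bilinearZr op_bil).
rewrite /GRing.add /= /ps_add !psT_scaleE /=.
by rewrite !addr0.
Qed.

Lemma coef1_bilinear f g :
  op f g 1%N = op (psC (f 0%N)) (psC (g 0%N)) 1%N
    + op (psC (f 0%N)) (psC (g 1%N)) 0%N + op (psC (f 1%N)) (psC (g 0%N)) 0%N.
Proof.
rewrite {1}(ps_shiftE f) {1}(ps_shiftE g) !(bilinearE op_bil).
rewrite !(bilinearZl op_bil, bilinearZr op_bil).
rewrite /GRing.add /= /ps_add !psT_scaleE /= addr0.
by rewrite [op _ (ps_shift _) _]coef0_bilinear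
           [op (ps_shift _) _ _]coef0_bilinear.
Qed.

End Series.

(** * The F-manifold structure *)

Theorem theorem5p15 (K : fieldType) (char0 : [pchar K] =i pred0)
    (A : lmodType K) (ast vee : A -> A -> A)
    (hA : NS_commutative ast vee)
    (rhd lhd circ : nat -> A -> A -> A)
    (rhdt lhdt circt : pseries A -> pseries A -> pseries A)
    (hdef : NS_preLie_deformation
              ast (fun x y => ast y x) vee
              rhd lhd circ rhdt lhdt circt) :
  let diam (x y : A) := rhd 1%N x y - lhd 1%N y x in
  let bul (x y : A) := circ 1%N x y - circ 1%N y x in
  [/\ forall x y : A,
        quot_t_at0 (rhdt (psC x) (psC y) - lhdt (psC y) (psC x)) (diam x y),
      forall x y : A,
        quot_t_at0 (circt (psC x) (psC y) - circt (psC y) (psC x)) (bul x y)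
    & NS_Fmanifold ast vee diam bul].
Proof.
move=> diam bul.
case: hdef => hr hl hc r0 l0 c0 rt lt ct hNS.
have [hrt hlt hct _ _ _] := hNS; have [ha hv veeC _ _] := hA.
pose diamt f g := ps_shift (rhdt f g - lhdt g f).
pose bult f g := ps_shift (circt f g - circt g f).
have rt0 f g : rhdt f g 0%N = ast (f 0%N) (g 0%N).
  by rewrite coef0_bilinear // rt r0.
have lt0 f g : lhdt f g 0%N = ast (g 0%N) (f 0%N).
  by rewrite coef0_bilinear // lt l0.
have ct0 f g : circt f g 0%N = vee (f 0%N) (g 0%N).
  by rewrite coef0_bilinear // ct c0.
have diamtE f g : psT K *: diamt f g = rhdt f g - lhdt g f.
  apply: psT_shift.
  by rewrite -[LHS]/(rhdt f g 0%N - lhdt g f 0%N) rt0 lt0 subrr.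
have bultE f g : psT K *: bult f g = circt f g - circt g f.
  apply: psT_shift.
  by rewrite -[LHS]/(circt f g 0%N - circt g f 0%N) !ct0 veeC subrr.
(* The contributions of f 1 and g 1 to the coefficient of t cancel, because the
   operations agree up to a swap at t = 0. *)
have diamt0 f g : diamt f g 0%N = diam (f 0%N) (g 0%N).
  rewrite -[LHS]/(rhdt f g 1%N - lhdt g f 1%N).
  rewrite (coef1_bilinear hrt) (coef1_bilinear hlt) rt lt !rt0 !lt0.
  by rewrite /diam /psC /=; zmodule.
have bult0 f g : bult f g 0%N = bul (f 0%N) (g 0%N).
  rewrite -[LHS]/(circt f g 1%N - circt g f 1%N).
  rewrite (coef1_bilinear hct f) (coef1_bilinear hct g).
  rewrite !ct0 /psC !ct /bul /= ![vee (f _) _]veeC; zmodule.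
split=> [x y|x y|].
- by exists (diamt (psC x) (psC y)); rewrite ?diamtE // diamt0.
- by exists (bult (psC x) (psC y)); rewrite ?bultE // bult0.
pose D := (pseries A * pseries A)%type.
pose mul := semidirect rhdt lhdt circt.
pose br : D -> D -> D := semidirect diamt (fun f g => - diamt g f) bult.
pose red (X : D) : A * A := (X.1 0%N, X.2 0%N).
pose lift (x : A * A) : D := (psC x.1, psC x.2).
pose mul0 := semidirect ast (fun x y => ast y x) vee.
pose br0 := semidirect diam (fun x y => - diam y x) bul.
have mul_bil : is_bilinear mul by apply: semidirect_bilinear.
have mul_leftsym X Y Z :
    associator mul X Y Z = associator mul Y X Z.
  exact: semidirect_leftsym hNS X Y Z.
have t_reg : injective (fun X : D => psT K *: X).
  by move=> [f g] [f' g'] [/psT_scaleI -> /psT_scaleI ->].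
have tBD (u v w : pseries A) :
    psT K *: (u - v + w) = psT K *: u - psT K *: v + psT K *: w.
  by rewrite scalerDr scalerBr.
have brE X Y : psT K *: br X Y = mul X Y - mul Y X.
  by congr (_, _); rewrite [LHS]tBD !diamtE bultE /=; zmodule.
have redD : {morph red : X Y / X + Y} by [].
have liftK : cancel lift red by case.
have red_t X : red (psT K *: X) = 0.
  by congr (_, _); [exact: (psT_scaleE X.1 0)|exact: (psT_scaleE X.2 0)].
have coef0D (u v w : pseries A) :
  (u + v + w) 0%N = u 0%N + v 0%N + w 0%N by [].
have coef0N (u : pseries A) : (- u) 0%N = - u 0%N by [].
have red_mul X Y : red (mul X Y) = mul0 (red X) (red Y).
  by congr (_, _); rewrite [LHS]coef0D rt0 lt0 ct0.
have red_br X Y : red (br X Y) = br0 (red X) (red Y).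
  by congr (_, _); rewrite [LHS]coef0D [X in _ + X + _]coef0N !diamt0 bult0.
apply: NS_Fmanifold_of_semidirect => //; last first.
  exact: (reduced_leibnizator_mul t_reg mul_bil mul_leftsym brE redD liftK red_t
           red_mul red_br).
apply: NS_Lie_of_semidirect => [||x y|].
- exact: bilinear_sub_swap.
- exact: bilinear_sub_swap.
- by rewrite /bul opprB.
- exact: (reduced_Jacobi t_reg mul_bil mul_leftsym brE redD liftK red_t red_br).
Qed.
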